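(* For every graph $G=(V,E)$ with positive edge weights $w$, the distributed greedy protocol $\mathcal P$ (defined in the context) computes a matching $M(G)$ of $G$ such that $$w(M(G)) \ge \tfrac{1}{2}\, w(M^*(G)),$$ where $M^*(G)$ is a maximum weighted matching of $G$, and it does so in time $O(|E|)$.
   Context: Graphs $G=(V,E)$ are finite, simple and undirected, with edge weights $w(e)>0$ for $e\in E$; $(u,v)$ denotes the undirected edge between $u$ and $v$, and $\Gamma(v)$ is the set of neighbours of $v$. A matching of $G$ is a subgraph (set of edges) in which no two edges are incident to the same vertex. The weight of a subgraph is the sum of the weights of its edges, and a maximum weighted matching $M^*(G)$ is a matching of maximum weight among all matchings of $G$. Edge weights are assumed to be unique; if they are not, ties are broken using node identities, i.e. all comparisons of edge weights are made with respect to one fixed strict total order on $E$ that refines the order by weight. Model: nodes of $V$ form an asynchronous distributed system, sending messages to neighbours over the edges in $E$. Message passing is asynchronous but reliable: every message sent is eventually delivered, exactly once, after an arbitrary finite delay. All nodes start in the wake-up event of the algorithm. A run is a sequence of atomic steps, where after wake-up each step consists of one node executing one iteration of its loop. Messages to terminated nodes are ignored. Time is the usual asynchronous time: local computation takes no time and each message takes at most one time unit. For a node $u$ and a set $N\subseteq\Gamma(u)$, $\mathrm{candidate}(u,N)$ is the node $v\in N$ with $w(u,v)\ge w(u,v')$ for all $v'\in N$, and $\mathrm{candidate}(u,\emptyset)=\bot$. Protocol $\mathcal P$, as executed by each node $v$ with local variables $R,N,c$ (written $R_v,N_v,c_v$): Initialise $R:=\emptyset$, $N:=\Gamma(v)$,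 $c:=\mathrm{candidate}(v,N)$; if $c\ne\bot$, send $\langle \mathrm{req}\rangle$ to $c$. While $N\neq\emptyset$ do the following. (1) Wait for and receive a message $m$ from some neighbour $u$. (2) If $m=\langle \mathrm{req}\rangle$, set $R:=R\cup\{u\}$. (3) If $m=\langle \mathrm{drop}\rangle$, set $N:=N\setminus\{u\}$, and then, if $u=c$, set $c:=\mathrm{candidate}(v,N)$ and, if this new $c\neq\bot$, send $\langle \mathrm{req}\rangle$ to $c$. (4) If $c\ne\bot$ and $c\in R$, send $\langle \mathrm{drop}\rangle$ to every $x\in N\setminus\{c\}$ and set $N:=\emptyset$. The node terminates when the loop ends. On termination, if $c_v\ne\bot$ then the edge $(v,c_v)$ belongs to the output; the computed $M(G)$ is the set of all edges $(v,c_v)$, $v\in V$, with $c_v\neq\bot$ on termination. *)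

(* Defs.v *)
From HB Require Import structures.
From mathcomp Require Import all_boot all_order all_algebra.

Set Implicit Arguments.
Unset Strict Implicit.
Unset Printing Implicit Defensive.

Import Order.TTheory GRing.Theory Num.Theory.
Local Open Scope ring_scope.

(* A simple graph is a symmetric irreflexive [adj : rel V]; the undirected edge
   between u and v is the two-element set [set u; v]. *)
Section Graphs.
Variables (V : finType) (adj : rel V).

Definition edges : {set {set V}} :=
  [set [set p.1; p.2] | p : V * V & adj p.1 p.2].

Definition neighbours (v : V) : {set V} := [set u | adj v u].

Definition is_matching (M : {set {set V}}) : bool :=
  (M \subset edges) && trivIset M.

Variables (R : realFieldType) (w : {set V} -> R).

Definition weight (M : {set {set V}}) : R := \sum_(e in M) w e.

Definition is_max_weight_matching (M : {set {set V}}) : Prop :=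
  is_matching M /\
  (forall M' : {set {set V}}, is_matching M' -> weight M' <= weight M).

(* The order by which edge weights are compared: it refines the order by weight,
   and ties are broken in an arbitrary but fixed way. *)
Definition tie_breaking_order (lt : rel {set V}) : Prop :=
  [/\ {in edges, forall e, ~~ lt e e},
      {in edges & &, forall f e g, lt e f -> lt f g -> lt e g},
      {in edges &, forall e f, e != f -> lt e f || lt f e}
    & {in edges &, forall e f, w e < w f -> lt e f}].

End Graphs.

Inductive message := Req | Drop.

Definition message_to_bool (m : message) : bool :=
  if m is Req then true else false.
Definition message_of_bool (b : bool) : message := if b then Req else Drop.
Lemma message_to_boolK : cancel message_to_bool message_of_bool.
Proof. by case. Qed.
HB.instance Definition _ := Equality.copy message (can_type message_to_boolK).

(* A message in transit, stamped with the index of the event that sent it.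
   Event 0 is the common wake-up, event k.+1 is the k-th step after wake-up.
   No event sends two messages over the same edge in the same direction, so
   distinct messages are distinct packets. *)
Record packet (V : Type) :=
  Packet { sent : nat; src : V; dst : V; body : message }.

Definition packet_to_tuple (V : Type) (p : packet V) :=
  (sent p, src p, dst p, body p).
Definition packet_of_tuple (V : Type) (t : nat * V * V * message) :=
  let: (k, u, v, m) := t in Packet k u v m.
Lemma packet_to_tupleK (V : Type) :
  cancel (@packet_to_tuple V) (@packet_of_tuple V).
Proof. by case. Qed.
HB.instance Definition _ (V : eqType) :=
  Equality.copy (packet V) (can_type (@packet_to_tupleK V)).

Section Protocol.
Variables (V : finType) (adj : rel V) (lt : rel {set V}).

(* [None] stands for bottom. *)
Definition candidate (u : V) (N : {set V}) : option V :=
  [pick v in N | [forall v' in N, ~~ lt [set u; v] [set u; v']]].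

Record local_state := LocalState {
  reqs : {set V};         (* R *)
  rest : {set V};         (* N *)
  cand : option V         (* c *)
}.

Definition request (c : option V) : seq (V * message) :=
  if c is Some x then [:: (x, Req)] else [::].

Definition init_state (v : V) : local_state :=
  LocalState set0 (neighbours adj v) (candidate v (neighbours adj v)).

Definition handle_req (u : V) (m : message) (s : local_state) : local_state :=
  if m is Req then LocalState (u |: reqs s) (rest s) (cand s) else s.

Definition handle_drop (v u : V) (m : message) (s : local_state) :
    local_state * seq (V * message) :=
  if m is Drop then
    let N' := rest s :\ u in
    if cand s == Some u then
      let c' := candidate v N' in
      (LocalState (reqs s) N' c', request c')
    else (LocalState (reqs s) N' (cand s), [::])
  else (s, [::]).

Definition finalize (s : local_state) : local_state * seq (V * message) :=
  if cand s is Some x then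
    if x \in reqs s then
      (LocalState (reqs s) set0 (cand s),
       [seq (y, Drop) | y <- enum (rest s :\ x)])
    else (s, [::])
  else (s, [::]).

(* One iteration of the loop of v, receiving m from u: the new local state and
   the messages sent, with their destinations. *)
Definition iteration (v u : V) (m : message) (s : local_state) :
    local_state * seq (V * message) :=
  let: (s3, out3) := handle_drop v u m (handle_req u m s) in
  let: (s4, out4) := finalize s3 in
  (s4, out3 ++ out4).

Record config := Config {
  local : {ffun V -> local_state};
  transit : seq (packet V)       (* unordered: channels need not be FIFO *)
}.

Definition packets (k : nat) (v : V) (out : seq (V * message)) :
    seq (packet V) :=
  [seq Packet k v o.1 o.2 | o <- out].

Definition wake_up : config :=
  Config [ffun v => init_state v]
    (flatten [seq packets 0 v (request (cand (init_state v))) | v <- enum V]).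

(* Guard of the loop: a node has terminated iff its N is empty. *)
Definition terminated (s : config) (v : V) : bool := rest (local s v) == set0.

Definition all_terminated (s : config) : bool := [forall v, terminated s v].

(* Effect of event k, in which the destination of p receives p. *)
Definition receive (k : nat) (p : packet V) (s : config) : config :=
  let v := dst p in
  let: (sv, out) := iteration v (src p) (body p) (local s v) in
  Config [ffun x => if x == v then sv else local s x]
         (rem p (transit s) ++ packets k v out).

(* [conf k] is the configuration after event k; [ev k] is the packet received in
   event k.+1, or [None] if nothing happens then.  Idle events let one type of
   sequences cover finite and infinite runs.  Terminated nodes take no step:
   packets addressed to them are ignored and stay in [transit]. *)
Record is_run (conf : nat -> config) (ev : nat -> option (packet V)) : Prop := {
  run_wake_up : conf 0%N = wake_up;
  run_idle : forall k, ev k = None -> conf k.+1 = conf k;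
  run_step : forall k p, ev k = Some p ->
    [/\ p \in transit (conf k), ~~ terminated (conf k) (dst p)
      & conf k.+1 = receive k.+1 p (conf k)];
  run_reliable : forall k p, p \in transit (conf k) ->
    exists2 j, (k <= j)%N & ev j = Some p \/ terminated (conf j) (dst p)
}.

(* [t k] is the time of event k. Local computation is instantaneous, so a packet
   is processed when it is delivered, at most one time unit after its sending. *)
Record is_timing (R : realFieldType) (ev : nat -> option (packet V))
    (t : nat -> R) : Prop := {
  timing_start : t 0%N = 0;
  timing_mono : forall k, t k <= t k.+1;
  timing_delay : forall k p, ev k = Some p -> t k.+1 <= t (sent p) + 1
}.

Definition output (s : config) : {set {set V}} :=
  [set [set p.1; p.2] | p : V * V & cand (local s p.1) == Some p.2].

End Protocol.

(* Main.v *)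
(* Every edge removed from some N is dominated by an output edge that is at
   least as heavy and shares an endpoint with it: a node v finalizing with c_v
   prefers (v, c_v) to all edges it drops, and c_v, having sent a request to v,
   never changes its candidate again. Charging each edge of a matching M' to such
   an endpoint charges every output edge at most twice.
   The protocol cannot get stuck: if no message can be received, the live edges
   are symmetric, and the endpoints of a maximal live edge have requested each
   other. The number of messages in transit plus the sum of all |N_v| is at most
   4|E| initially and drops with every reception, since sending a message always
   costs an element of some N_v. This gives termination, and also the time bound,
   because a packet received as the n-th message arrives by time n. *)

Require Import Defs.
From mathcomp Require Import all_boot all_order all_algebra zify.

Set Implicit Arguments.
Unset Strict Implicit.
Unset Printing Implicit Defensive.

Import Order.TTheory GRing.Theory Num.Theory.
Local Open Scope ring_scope.

(** * Edges as two-element sets and the degree sum *)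

Lemma set2_injr (T : finType) (x : T) : injective (fun y => [set x; y]).
Proof.
move=> y z eq_yz; have := set22 x y; rewrite eq_yz !inE => /orP[/eqP yx|/eqP//].
by have := set22 x z; rewrite -eq_yz !inE yx orbb => /eqP.
Qed.

Section Graphs.
Variables (V : finType) (adj : rel V).

Lemma mem_edges u v : adj u v -> [set u; v] \in edges adj.
Proof. by move=> uv; apply/imsetP; exists (u, v); rewrite ?inE. Qed.

(** Double counting of incidences: the neighbours of [v] inject into the edges through [v], and an
    edge has at most two endpoints. *)
Lemma sum_card_neighbours :
  (\sum_v #|neighbours adj v| <= 2 * #|edges adj|)%N.
Proof.
apply: (@leq_trans (\sum_v \sum_(e in edges adj) (v \in e))).
  apply: leq_sum => v _; rewrite -(card_imset _ (@set2_injr _ v)).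
  rewrite -big_mkcondr sum1_card; apply: subset_leq_card; apply/subsetP => e.
  case/imsetP=> u; rewrite inE => vu ->.
  by rewrite unfold_in mem_edges ?set21.
rewrite exchange_big /= mulnC -sum_nat_const; apply: leq_sum => e /imsetP[p _ ->].
by rewrite -big_mkcond sum1_card cards2; case: (_ != _).
Qed.

(** * Half of the optimal weight from mutual candidates *)

Section Matching.
Variables (R : realFieldType) (w : {set V} -> R) (c : V -> option V).
Hypothesis w_gt0 : forall e, e \in edges adj -> 0 < w e.
Hypothesis c_adj : forall v x, c v = Some x -> adj v x.
Hypothesis c_mutual : forall v x, c v = Some x -> c x = Some v.

Let M := [set [set p.1; p.2] | p : V * V & c p.1 == Some p.2].

(** By mutuality an edge of [M] is determined by either of its endpoints, which makes the edges of
    [M] disjoint. *)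
Lemma mutual_edge e z :
  e \in M -> z \in e -> exists2 x, c z = Some x & e = [set z; x].
Proof.
case/imsetP=> -[a b]; rewrite !inE /= => /eqP ab -> /set2P[]->.
  by exists b.
by exists a; [apply: c_mutual | rewrite setUC].
Qed.

Lemma mutual_is_matching : is_matching adj M.
Proof.
apply/andP; split.
  apply/subsetP=> e /imsetP[[a b]]; rewrite !inE /= => /eqP ab ->.
  exact/mem_edges/c_adj.
apply/trivIsetP => e f eM fM; apply: contraNT => /pred0Pn[z /andP[/= ze zf]].
have [x cz ->] := mutual_edge eM ze; have [y] := mutual_edge fM zf.
by rewrite cz => -[<-] ->.
Qed.

Lemma mutual_half_weight (M' : {set {set V}}) :
    (forall u v, adj u v ->
       exists x y, [/\ x \in [set u; v], c x = Some y
                     & w [set u; v] <= w [set x; y]]) ->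
  is_matching adj M' -> weight w M' <= weight w M *+ 2.
Proof.
move=> domin /andP[/subsetP subM' trivM'].
have /andP[_ trivM] := mutual_is_matching.
(* The vertex [v] pays the weight of its edge in [M], or 0 if it has none; the dominating endpoint
   of an edge of [M'] pays enough for that edge. *)
pose f v := if c v is Some x then w [set v; x] else 0.
have f_ge0 v : 0 <= f v.
  rewrite /f; case cv: (c v) => [x|] //.
  exact/ltW/w_gt0/mem_edges/c_adj.
apply: (@le_trans _ _ (\sum_(e in M') \sum_(v in e) f v)).
  apply: ler_sum => e /subM' /imsetP[[u v]]; rewrite inE /= => uv ->.
  have [x [y [xuv cx le_w]]] := domin u v uv.
  rewrite (bigD1 x xuv) /= {1}/f cx (le_trans le_w) // lerDl.
  exact: sumr_ge0.
(* The edges of [M'] are disjoint, so each vertex pays at most once; all payments come from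
   [cover M], outside which [f] vanishes. *)
rewrite -(big_trivIset _ trivM') /=.
apply: (@le_trans _ _ (\sum_(v in cover M) f v)).
  rewrite big_mkcond [leRHS]big_mkcond; apply: ler_sum => v _.
  case: (boolP (v \in cover M)) => [|vM]; case: ifP => //.
  rewrite /f; case cv: (c v) => [x|] // _; case/negP: vM.
  apply/bigcupP; exists [set v; x]; rewrite ?set21 //.
  by apply/imsetP; exists (v, x); rewrite ?inE /= ?cv.
rewrite (big_trivIset _ trivM) /= -sumrMnl; apply: ler_sum => e eM.
(* Both endpoints of an edge of [M] pay its weight, whence the factor 2. *)
rewrite (eq_bigr (fun _ => w e)); last first.
  by move=> v /(mutual_edge eM)[x]; rewrite /f => -> <-.
rewrite sumr_const; case/imsetP: (eM) => -[a b]; rewrite inE /= => /eqP ab ->.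
rewrite ler_wpMn2l //; last by rewrite cards2; case: (_ != _).
exact/ltW/w_gt0/mem_edges/c_adj.
Qed.

End Matching.
End Graphs.

(** * Heaviest edges and candidates *)

Section Execution.
Local Open Scope nat_scope.
Variables (V : finType) (adj : rel V) (lt : rel {set V}).
Hypotheses (adj_sym : symmetric adj) (adj_irr : irreflexive adj).
Hypothesis lt_irr : {in edges adj, forall e, ~~ lt e e}.
Hypothesis lt_trans :
  {in edges adj & &, forall f e g, lt e f -> lt f g -> lt e g}.
Hypothesis lt_total : {in edges adj &, forall e f, e != f -> lt e f || lt f e}.

(** A member of [S] with the fewest members of [S] above it is maximal: by transitivity, any member
    above it would have strictly fewer. *)
Lemma maximal_edge (S : {set {set V}}) :
  S \subset edges adj -> S != set0 ->
  exists2 e, e \in S & {in S, forall f, ~~ lt e f}.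
Proof.
move=> /subsetP sub_S /set0Pn[e0 e0S].
case: (arg_minnP (fun e => #|[set f in S | lt e f]|) e0S) => e eS min_e.
exists e => // f fS; apply/negP=> lt_ef; have := min_e f fS.
rewrite leqNgt => /negP[]; apply: proper_card; apply/properP; split.
  apply/subsetP=> g; rewrite !inE => /andP[gS lt_fg]; rewrite gS.
  by apply: lt_trans lt_ef lt_fg; apply: sub_S.
by exists f; rewrite !inE fS //= lt_irr ?sub_S.
Qed.

(** The [pick] in [candidate] could fail a priori; the existence of a maximal edge confines failure
    to empty [N]. *)
Lemma candidateP v (N : {set V}) :
  N \subset neighbours adj v ->
  if candidate lt v N is Some x
  then x \in N /\ {in N, forall y, ~~ lt [set v; x] [set v; y]}
  else N = set0.
Proof.
move=> /subsetP sub_N; rewrite /candidate; case: pickP.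
  by move=> x /andP[xN /forall_inP].
move=> no_max; apply/eqP; apply: contraT => N_neq0.
have [||e /imsetP[x xN ->] max_x] :=
  @maximal_edge [set [set v; y] | y in N].
- apply/subsetP=> e /imsetP[y /sub_N]; rewrite inE => vy ->.
  exact: mem_edges.
- have [y yN] := set0Pn _ N_neq0; apply/set0Pn; exists [set v; y].
  exact: imset_f.
have /negP[] := negbT (no_max x); rewrite xN; apply/forall_inP => y yN.
exact/max_x/imset_f.
Qed.

(** * The invariant of configurations *)

Definition pending (T : seq (packet V)) (m : message) (u v : V) : bool :=
  has (fun p => [&& body p == m, src p == u & dst p == v]) T.

Lemma pending_cat T1 T2 m u v :
  pending (T1 ++ T2) m u v = pending T1 m u v || pending T2 m u v.
Proof. exact: has_cat. Qed.

Lemma pending_packets k x (out : seq (V * message)) m u v :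
  pending (packets k x out) m u v = (u == x) && ((v, m) \in out).
Proof.
rewrite /pending has_map; apply/hasP/andP => [[[y m'] yout]|[/eqP-> vout]].
  by rewrite /= => /and3P[/eqP<- /eqP-> /eqP<-].
by exists (v, m); rewrite //= !eqxx.
Qed.

Lemma pending_rem T p m u v :
  p \in T ->
  pending T m u v =
    [&& body p == m, src p == u & dst p == v] || pending (rem p T) m u v.
Proof. by move=> pT; rewrite /pending (perm_has _ (perm_to_rem pT)). Qed.

Lemma mem_request (c : option V) x m :
  ((x, m) \in request c) = (c == Some x) && (m == Req).
Proof. by case: c => [y|] //=; rewrite inE xpair_eqE /= eq_sym. Qed.

Definition update (f : {ffun V -> local_state V}) v (ls : local_state V) :=
  [ffun x => if x == v then ls else f x].

(** The certificate for giving up the edge between [u] and [v]. It persists, because only nodes with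
    nonempty [rest] take steps. *)
Definition dominates (f : {ffun V -> local_state V}) u v : Prop :=
  rest (f u) = set0 /\
  exists2 x, cand (f u) = Some x & ~~ lt [set u; x] [set u; v].

Definition requested (f : {ffun V -> local_state V}) T u v : bool :=
  (u \in reqs (f v)) || pending T Req u v.

(** [inv_matched] with [inv_requested] makes the final candidates mutual, [inv_dom] gives the weight
    bound, and [inv_stale] prevents waiting forever for a finished neighbour. The second case of
    [inv_requested] is a request whose target finished without choosing the sender. *)
Record invariant (f : {ffun V -> local_state V}) (T : seq (packet V)) : Prop := {
  inv_adj : forall u v, v \in rest (f u) -> adj u v;
  inv_cand_adj : forall u v, cand (f u) = Some v -> adj u v;
  inv_cand : forall v, rest (f v) != set0 ->
    exists x, [/\ cand (f v) = Some x, x \in rest (f v)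
      & {in rest (f v), forall y, ~~ lt [set v; x] [set v; y]}];
  inv_requested : forall u v, requested f T u v ->
    cand (f u) = Some v \/ rest (f v) = set0 /\ cand (f v) <> Some u;
  inv_request : forall u v, cand (f u) = Some v -> requested f T u v;
  inv_matched : forall u v,
    rest (f u) = set0 -> cand (f u) = Some v -> v \in reqs (f u);
  inv_drop : forall u v, pending T Drop u v ->
    cand (f u) <> Some v /\ dominates f u v;
  inv_stale : forall u v, v \in rest (f u) -> rest (f v) = set0 ->
    pending T Drop v u \/ cand (f v) = Some u;
  inv_dom : forall u v, adj u v -> v \notin rest (f u) ->
    dominates f u v \/ dominates f v u
}.

(** * Preservation of the invariant *)

Lemma dominates_update (f : {ffun V -> local_state V}) v ls a b :
  rest (f v) != set0 -> dominates f a b -> dominates (update f v ls) a b.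
Proof.
move=> nz [a0 h]; rewrite /dominates ffunE; case: eqP => // av.
by rewrite -av a0 eqxx in nz.
Qed.

(** In transit are exactly the requests to the initial candidates; nodes finished from the start are
    isolated and have no candidate. *)
Lemma invariant_wake_up :
  invariant (local (wake_up adj lt)) (transit (wake_up adj lt)).
Proof.
have loc v : local (wake_up adj lt) v = init_state adj lt v by rewrite ffunE.
have candP v := candidateP (subxx (neighbours adj v)).
have pendE m u v : pending (transit (wake_up adj lt)) m u v =
    (candidate lt u (neighbours adj u) == Some v) && (m == Req).
  rewrite -[candidate _ _ _]/(cand (init_state adj lt u)) -mem_request.
  apply/hasP/idP => [[p /flatten_mapP[x _ px] p_uv]|cu].
    have: pending (packets 0 x (request (cand (init_state adj lt x)))) m u v.
      by apply/hasP; exists p.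
    by rewrite pending_packets => /andP[/eqP->].
  have: pending (packets 0 u (request (cand (init_state adj lt u)))) m u v.
    by rewrite pending_packets eqxx.
  case/hasP=> p pu p_uv; exists p => //; apply/flatten_mapP; exists u => //.
  by rewrite mem_enum.
split=> [u v|u v|v|u v|u v|u v|u v|u v|u v];
  rewrite /requested ?pendE !loc /= ?inE //.
- by have := candP u; case: candidate => // x [+ _] [<-]; rewrite inE.
- have := candP v; case: candidate => [x [x_in x_max] _|-> /eqP//].
  by exists x.
- by rewrite andbT => /eqP->; left.
- by move=> ->; rewrite !eqxx.
- have := candP u; case: candidate => // x [x_in _] n0.
  by rewrite n0 inE in x_in.
- by rewrite andbF.
- by move=> uv /setP/(_ u); rewrite !inE adj_sym uv.
- by move=> ->.
Qed.

(** Receiving a request moves it from transit to [reqs], so [requested] is unchanged, as are all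
    [rest] and [cand]. *)
Lemma invariant_req (f : {ffun V -> local_state V}) T p :
  p \in T -> body p = Req -> invariant f T ->
  invariant (update f (dst p) (handle_req (src p) Req (f (dst p)))) (rem p T).
Proof.
move=> pT pR inv; set f' := update _ _ _.
have restE x : rest (f' x) = rest (f x).
  by rewrite /f' ffunE; case: eqP => [->|].
have candE x : cand (f' x) = cand (f x).
  by rewrite /f' ffunE; case: eqP => [->|].
have reqsE x y : (y \in reqs (f' x)) =
    (x == dst p) && (y == src p) || (y \in reqs (f x)).
  by rewrite /f' ffunE; case: eqP => [->|] //=; rewrite !inE.
have reqE u v : requested f' (rem p T) u v = requested f T u v.
  rewrite /requested reqsE (pending_rem _ _ _ pT) pR eqxx /=.
  by rewrite (eq_sym v) (eq_sym u) andbC -orbA orbCA.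
have dropE u v : pending (rem p T) Drop u v = pending T Drop u v.
  by rewrite (pending_rem _ _ _ pT) pR.
case: inv => h1 h2 h3 h4 h5 h6 h7 h8 h9.
split=> [u v|u v|v|u v|u v|u v|u v|u v|u v];
  rewrite /dominates ?restE ?candE ?reqE ?dropE //; eauto.
by move=> r0 /h6 -/(_ r0) vu; rewrite reqsE vu orbT.
Qed.

(** The sender of a drop is finished and dominates its edge to the receiver, so striking it from
    [rest] respects [inv_dom]; the consumed packet served [inv_stale] only for the pair just
    struck. *)
Lemma invariant_drop k (f : {ffun V -> local_state V}) T p :
  p \in T -> body p = Drop -> rest (f (dst p)) != set0 -> invariant f T ->
  let: (ls, out) := handle_drop lt (dst p) (src p) Drop (f (dst p)) in
  invariant (update f (dst p) ls) (rem p T ++ packets k (dst p) out).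
Proof.
move=> pT pD; set v := dst p; set u := src p => nzv inv.
have [cu domu] : cand (f u) <> Some v /\ dominates f u v.
  by apply: (inv_drop inv); apply/hasP; exists p; rewrite // pD !eqxx.
have [ru0 _] := domu.
have uv : u != v by apply: contraNneq nzv => <-; rewrite ru0.
have dead x : rest (f x) = set0 -> x != v.
  by move=> x0; apply: contraNneq nzv => <-; rewrite x0.
have pendE m a b : pending (rem p T) m a b -> pending T m a b.
  by rewrite (pending_rem m a b pT) => ->; rewrite orbT.
have pend_req a b : pending (rem p T) Req a b = pending T Req a b.
  by rewrite (pending_rem _ _ _ pT) pD.
have pend_drop a b : pending T Drop a b -> (a != u) || (b != v) ->
    pending (rem p T) Drop a b.
  rewrite (pending_rem _ _ _ pT) pD eqxx /= -/u -/v -negb_and (eq_sym a) (eq_sym b).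
  by case/orP=> // ->.
have [x [cv xv xmax]] := inv_cand inv nzv.
rewrite /handle_drop cv; case: ifP => [/eqP[xu]|/eqP xu].
  have sub_N : rest (f v) :\ u \subset neighbours adj v.
    by apply/subsetP=> y /setD1P[_ /(inv_adj inv)]; rewrite inE.
  have := candidateP sub_N; set c' := candidate _ _ _ => c'P.
  set f' := update _ _ _; set T' := _ ++ _.
  have f'v : f' v = LocalState (reqs (f v)) (rest (f v) :\ u) c'.
    by rewrite /f' ffunE eqxx.
  have f'x y : y != v -> f' y = f y by rewrite /f' ffunE => /negPf->.
  have reqsE y : reqs (f' y) = reqs (f y).
    by have [->|/f'x->//] := eqVneq y v; rewrite f'v.
  have dropE a b : pending T' Drop a b = pending (rem p T) Drop a b.
    by rewrite pending_cat pending_packets mem_request !andbF orbF.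
  have reqE a b : requested f' T' a b =
      requested f T a b || (a == v) && (c' == Some b).
    by rewrite /requested reqsE pending_cat pending_packets mem_request andbT
      pend_req orbA.
  split.
  - move=> a b; have [->|/f'x->] := eqVneq a v; last exact: (inv_adj inv).
    by rewrite f'v => /setD1P[_]; apply: (inv_adj inv).
  - move=> a b; have [->|/f'x->] := eqVneq a v; last exact: (inv_cand_adj inv).
    rewrite f'v /= => c'b; rewrite c'b in c'P; have [/setD1P[_]] := c'P.
    by move=> bv _; apply: (inv_adj inv) bv.
  - move=> a; have [->|/f'x->] := eqVneq a v; last exact: (inv_cand inv).
    rewrite f'v /=; case: c' c'P {f' T' f'v f'x reqsE dropE reqE} => [y|->].
      by case=> yN ymax _; exists y.
    by rewrite eqxx.
  - move=> a b; rewrite reqE => /orP[ab|/andP[/eqP-> /eqP c'b]]; last by rewrite f'v; left.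
    (* An old request of [v] went to its lost candidate [u] or to a target covered by the second
       case before; each is finished and did not choose [v]. *)
    have [av|av] := eqVneq a v.
      right; case: (inv_requested inv ab).
        by rewrite av cv xu => -[<-]; rewrite f'x.
      by case=> b0 cb; rewrite f'x ?dead // av.
    rewrite (f'x a) //; case: (inv_requested inv ab); first by left.
    by case=> b0 cb; right; rewrite f'x ?dead.
  - move=> a b; rewrite reqE; have [->|av] := eqVneq a v.
      by rewrite f'v /= => ->; rewrite eqxx orbT.
    by rewrite f'x // => /(inv_request inv) ->.
  - move=> a b; have [->|/f'x->] := eqVneq a v; last exact: (inv_matched inv).
    rewrite f'v /= => N0; case: c' c'P {f' T' f'v f'x reqsE dropE reqE} => // y [+ _].
    by rewrite N0 inE.
  - move=> a b; rewrite dropE => /pendE/(inv_drop inv)[ca domab].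
    by rewrite f'x ?dead ?domab.1 //; split=> //; apply: dominates_update.
  - move=> a b; rewrite dropE; have [->|av] := eqVneq a v.
      rewrite f'v /= => /setD1P[bu bv]; have bv' : b != v.
        by apply: contraTneq (inv_adj inv bv) => ->; rewrite adj_irr.
      rewrite f'x // => b0; case: (inv_stale inv bv b0); last by right.
      by move=> ?; left; apply: pend_drop; rewrite ?bu.
    rewrite f'x // => ba; have [bv|bv] := eqVneq b v; last first.
      rewrite f'x // => b0; case: (inv_stale inv ba b0); last by right.
      by move=> ?; left; apply: pend_drop; rewrite ?av ?orbT.
    have alive_a : rest (f a) != set0 by apply/set0Pn; exists b.
    (* This case is void. If [a] was in [rest] of [v], it is the last member [u], which is finished;
       if it had left before, [inv_dom] would make [a] or [v] finished already. *)
    rewrite bv f'v /= => N0; case: (boolP (a \in rest (f v))) => [a_v|].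
      have := in_set0 a; rewrite -N0 !inE a_v andbT => /negbFE/eqP au.
      by rewrite au ru0 eqxx in alive_a.
    rewrite bv in ba; case/(inv_dom inv); first by rewrite adj_sym (inv_adj inv ba).
      by case=> v0; rewrite v0 eqxx in nzv.
    by case=> a0; rewrite a0 eqxx in alive_a.
  - move=> a b ab nab.
    suff: dominates f a b \/ dominates f b a.
      by case=> ?; [left|right]; apply: dominates_update.
    have [av|av] := eqVneq a v; last first.
      by rewrite f'x in nab => //; apply: (inv_dom inv).
    have [->|bu] := eqVneq b u; first by right; rewrite av.
    apply: (inv_dom inv) => //; apply: contra nab; rewrite av f'v /= => bv.
    by rewrite !inE bu.
(* Here the candidate [x] differs from [u] and stays in [rest], so [v] remains alive and sends
   nothing. *)
rewrite cats0; set f' := update _ _ _.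
have f'v : f' v = LocalState (reqs (f v)) (rest (f v) :\ u) (Some x).
  by rewrite /f' ffunE eqxx.
have f'x y : y != v -> f' y = f y by rewrite /f' ffunE => /negPf->.
have reqsE y : reqs (f' y) = reqs (f y).
  by have [->|/f'x->//] := eqVneq y v; rewrite f'v.
have candE y : cand (f' y) = cand (f y).
  by have [->|/f'x->//] := eqVneq y v; rewrite f'v cv.
have xv' : x \in rest (f' v).
  by rewrite f'v !inE xv andbT; apply/eqP=> xu'; case: xu; rewrite xu'.
have nzv' : rest (f' v) != set0 by apply/set0Pn; exists x.
have restE y : (rest (f' y) == set0) = (rest (f y) == set0).
  have [->|/f'x->//] := eqVneq y v.
  by rewrite (negPf nzv) (negPf nzv').
have sub y z : z \in rest (f' y) -> z \in rest (f y).
  by have [->|/f'x->//] := eqVneq y v; rewrite f'v => /setD1P[].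
have reqE a b : requested f' (rem p T) a b = requested f T a b.
  by rewrite /requested reqsE pend_req.
split.
- by move=> a b /sub; apply: (inv_adj inv).
- by move=> a b; rewrite candE; apply: (inv_cand_adj inv).
- move=> a; have [->|/f'x->] := eqVneq a v; last exact: (inv_cand inv).
  by exists x; split=> [||y /sub /xmax] //; rewrite f'v.
- move=> a b; rewrite reqE !candE => /(inv_requested inv)[|[/eqP b0 cb]]; first by left.
  by right; split=> //; apply/eqP; rewrite restE.
- by move=> a b; rewrite reqE candE; apply: (inv_request inv).
- move=> a b /eqP; rewrite restE candE reqsE => /eqP.
  exact: (inv_matched inv).
- move=> a b /pendE/(inv_drop inv)[ca domab].
  by rewrite candE; split=> //; apply: dominates_update.
- move=> a b ba /eqP; rewrite restE candE => /eqP b0.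
  case: (inv_stale inv (sub _ _ ba) b0); last by right.
  move=> ?; left; apply: pend_drop => //; rewrite -negb_and; apply/negP.
  by case/andP=> /eqP bu /eqP av; move: ba; rewrite av f'v bu !inE eqxx.
- move=> a b ab nab.
  suff: dominates f a b \/ dominates f b a.
    by case=> ?; [left|right]; apply: dominates_update.
  have [av|av] := eqVneq a v; last first.
    by rewrite f'x in nab => //; apply: (inv_dom inv).
  have [->|bu] := eqVneq b u; first by right; rewrite av.
  apply: (inv_dom inv) => //; apply: contra nab; rewrite av f'v /= => bv.
  by rewrite !inE bu.
Qed.

Lemma update_id (f : {ffun V -> local_state V}) v : update f v (f v) = f.
Proof. by apply/ffunP => x; rewrite ffunE; case: eqP => [->|]. Qed.

(** A live [v] finalizes only if its candidate [x] has requested it, and then [x] still points at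
    [v]. As [x] is heaviest in [rest], the new edge dominates all edges dropped. *)
Lemma invariant_finalize k (f : {ffun V -> local_state V}) T v :
  invariant f T ->
  let: (ls, out) := finalize (f v) in
  invariant (update f v ls) (T ++ packets k v out).
Proof.
move=> inv; rewrite /finalize; case cv: (cand (f v)) => [x|]; last first.
  by rewrite cats0 update_id.
case: ifP => xR; last by rewrite cats0 update_id.
(* With [rest] already empty, finalizing changes nothing and sends nothing. *)
have [N0|nzv] := eqVneq (rest (f v)) set0.
  have -> : LocalState (reqs (f v)) set0 (Some x) = f v.
    by rewrite -cv -N0; case: (f v).
  by rewrite N0 set0D enum_set0 cats0 update_id.
have dead y : rest (f y) = set0 -> y != v.
  by move=> y0; apply: contraNneq nzv => <-; rewrite y0.
have cx : cand (f x) = Some v.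
  case: (inv_requested inv (u := x) (v := v)) => //; first by rewrite /requested xR.
  by case=> v0; rewrite v0 eqxx in nzv.
have [x' [cv' xv xmax]] := inv_cand inv nzv.
move: cv' xv xmax; rewrite cv => -[<-] {x'} xv xmax.
set f' := update _ _ _; set T' := _ ++ _.
have f'v : f' v = LocalState (reqs (f v)) set0 (Some x).
  by rewrite /f' ffunE eqxx.
have f'x y : y != v -> f' y = f y by rewrite /f' ffunE => /negPf->.
have reqsE y : reqs (f' y) = reqs (f y).
  by have [->|/f'x->//] := eqVneq y v; rewrite f'v.
have candE y : cand (f' y) = cand (f y).
  by have [->|/f'x->//] := eqVneq y v; rewrite f'v cv.
have pendE m a b : pending T' m a b =
    pending T m a b || [&& a == v, m == Drop, b != x & b \in rest (f v)].
  rewrite pending_cat pending_packets; congr (_ || (_ && _)); apply/mapP/idP.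
    by case=> y; rewrite mem_enum !inE => yP [-> ->]; rewrite eqxx.
  by case/andP=> /eqP-> bP; exists b; rewrite // mem_enum !inE.
have reqE a b : requested f' T' a b = requested f T a b.
  by rewrite /requested reqsE pendE andbF orbF.
have sub y z : z \in rest (f' y) -> z \in rest (f y).
  by have [->|/f'x->//] := eqVneq y v; rewrite f'v inE.
have alive a b : b \in rest (f a) -> rest (f a) != set0.
  by move=> ?; apply/set0Pn; exists b.
split.
- by move=> a b /sub; apply: (inv_adj inv).
- by move=> a b; rewrite candE; apply: (inv_cand_adj inv).
- move=> a; have [->|/f'x->] := eqVneq a v; last exact: (inv_cand inv).
  by rewrite f'v eqxx.
- move=> a b; rewrite reqE !candE => /(inv_requested inv)[|[b0 cb]]; first by left.
  by right; split=> //; rewrite f'x // dead.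
- by move=> a b; rewrite reqE candE; apply: (inv_request inv).
- move=> a b; rewrite reqsE candE; have [->|av] := eqVneq a v.
    by rewrite cv => _ [<-].
  by rewrite f'x //; apply: (inv_matched inv).
- move=> a b; rewrite pendE candE => /orP[/(inv_drop inv)[ca domab]|].
    by split=> //; apply: dominates_update.
  case/and4P=> /eqP-> _ bx b_v; split.
    by rewrite cv => -[xb]; rewrite xb eqxx in bx.
  by rewrite /dominates f'v; split=> //; exists x; rewrite ?xmax.
- move=> a b ba' b0'; have ba := sub _ _ ba'.
  have av : a != v by apply: contraTneq ba' => ->; rewrite f'v inE.
  rewrite pendE candE; have [bv|bv] := eqVneq b v; last first.
    rewrite f'x // in b0'; case: (inv_stale inv ba b0'); last by right.
    by move=> ->; left.
  rewrite bv cv /=; have [->|ax] := eqVneq a x; first by right.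
  (* A drop goes to [a] once [a] is known to be in [rest] of [v]; otherwise [inv_dom] would make [a]
     or [v] finished already. *)
  left; suff -> : a \in rest (f v) by rewrite orbT.
  apply: contraT => a_v; rewrite bv in ba.
  case: (inv_dom inv _ a_v); first by rewrite adj_sym (inv_adj inv ba).
    by case=> v0; rewrite v0 eqxx in nzv.
  by case=> a0; move: (alive _ _ ba); rewrite a0 eqxx.
- move=> a b ab nab; have [av|av] := eqVneq a v; last first.
    rewrite f'x // in nab; case: (inv_dom inv ab nab) => ?; [left|right];
      exact: dominates_update.
  (* Neighbours dropped now are dominated by the new edge of [v]; for those struck earlier,
     domination held before. *)
  have [b_v|b_v] := boolP (b \in rest (f v)).
    by left; rewrite av /dominates f'v; split=> //; exists x; rewrite ?xmax.
  rewrite -av in b_v; case: (inv_dom inv ab b_v) => ?; [left|right];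
    exact: dominates_update.
Qed.

(** Splits an event into its two halves, so that the separate results on them compose. *)
Lemma receive_local_transit k p (s : config V) :
  let v := dst p in
  let: (s3, out3) := handle_drop lt v (src p) (body p)
                       (handle_req (src p) (body p) (local s v)) in
  let: (s4, out4) := finalize s3 in
  receive lt k p s =
    Config (update (update (local s) v s3) v s4)
           ((rem p (transit s) ++ packets k v out3) ++ packets k v out4).
Proof.
rewrite /= /receive /iteration; case: handle_drop => s3 out3.
case: finalize => s4 out4; congr Config; last by rewrite -catA /packets map_cat.
by apply/ffunP => x; rewrite !ffunE; case: ifP.
Qed.

Lemma invariant_receive k p (s : config V) :
  p \in transit s -> ~~ terminated s (dst p) ->
  invariant (local s) (transit s) ->
  invariant (local (receive lt k p s)) (transit (receive lt k p s)).
Proof.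
move=> pT nz inv; have := receive_local_transit k p s => /=.
set hd := handle_drop _ _ _ _ _.
have : invariant (update (local s) (dst p) hd.1)
                 (rem p (transit s) ++ packets k (dst p) hd.2).
  rewrite {}/hd; case pB: (body p).
    by rewrite /= cats0; apply: invariant_req.
  have := invariant_drop k pT pB nz inv; rewrite [handle_req _ _ _]/=.
  by case: handle_drop.
case: hd => s3 out3 /= /(invariant_finalize k (dst p)).
by rewrite ffunE eqxx; case: finalize => s4 out4 inv' ->.
Qed.

(* Not a field of [invariant], because it fails between the two halves
   [handle_drop] and [finalize] of an iteration. *)
Lemma unmatched_receive k p (s : config V) :
  (forall v x, cand (local s v) = Some x -> x \in reqs (local s v) ->
     rest (local s v) = set0) ->
  forall v x, cand (local (receive lt k p s) v) = Some x ->
    x \in reqs (local (receive lt k p s) v) ->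
    rest (local (receive lt k p s) v) = set0.
Proof.
move=> unm v x; rewrite /receive /iteration; case: handle_drop => s3 out3.
rewrite /finalize; case c3: (cand s3) => [y|]; last first.
  by rewrite /= ffunE; case: eqP => [_|_ /unm //]; rewrite c3.
case: ifP => y3 /=; rewrite ffunE; case: eqP => [_|_ /unm //] //=.
by rewrite c3 => -[<-]; rewrite y3.
Qed.

(** * Deadlock freedom *)

Lemma deadlock_free (s : config V) :
  invariant (local s) (transit s) ->
  (forall v x, cand (local s v) = Some x -> x \in reqs (local s v) ->
     rest (local s v) = set0) ->
  ~~ all_terminated s ->
  exists2 p, p \in transit s & ~~ terminated s (dst p).
Proof.
move=> inv unm /forallPn[v0 nz0].
have [/hasP //|] := boolP (has (fun p => ~~ terminated s (dst p)) (transit s)).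
move/hasPn=> stuck; exfalso.
have no_pend m u v : rest (local s v) != set0 -> pending (transit s) m u v = false.
  move=> nz; apply/hasP=> -[p pT /and3P[_ _ /eqP pv]].
  by have := stuck p pT; rewrite /terminated pv nz.
have alive u v : v \in rest (local s u) -> rest (local s u) != set0.
  by move=> vu; apply/set0Pn; exists v.
have reqP u v : rest (local s v) != set0 -> cand (local s u) = Some v ->
    u \in reqs (local s v).
  by move=> nz /(inv_request inv); rewrite /requested no_pend ?orbF.
(* If a live [u] lists a finished [v], no drop is in transit, so [v] chose [u]. Then each points at
   the other and [u] has received the request of [v], against [unm]. *)
have live u v : v \in rest (local s u) -> rest (local s v) != set0.
  move=> vu; apply/eqP=> v0'; have nzu := alive _ _ vu.
  case: (inv_stale inv vu v0'); first by rewrite no_pend.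
  move=> cv; have uR := inv_matched inv v0' cv.
  case: (inv_requested inv (u := u) (v := v)); first by rewrite /requested uR.
    by move=> cu; have := unm _ _ cu (reqP _ _ nzu cv); apply/eqP.
  by case.
have sym u v : v \in rest (local s u) -> u \in rest (local s v).
  move=> vu; apply: contraT => uv.
  case: (inv_dom inv _ uv); first by rewrite adj_sym (inv_adj inv vu).
    by case=> v0'; move: (live _ _ vu); rewrite v0' eqxx.
  by case=> u0; move: (alive _ _ vu); rewrite u0 eqxx.
pose S := [set [set p.1; p.2] | p : V * V & p.2 \in rest (local s p.1)].
have memS u v : v \in rest (local s u) -> [set u; v] \in S.
  by move=> vu; apply/imsetP; exists (u, v); rewrite ?inE.
have sub_S : S \subset edges adj.
  apply/subsetP=> e /imsetP[[u v]]; rewrite inE /= => vu ->.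
  exact/mem_edges/(inv_adj inv).
have [|e /imsetP[[u v]]] := maximal_edge sub_S.
  have [y y0] := set0Pn _ nz0; apply/set0Pn; exists [set v0; y]; exact: memS.
rewrite inE /= => vu -> max_uv.
(* An endpoint of the maximal live edge has that edge as its candidate edge: neither exceeds the
   other, so they agree by totality. *)
have best a b : b \in rest (local s a) -> [set a; b] = [set u; v] ->
    cand (local s a) = Some b.
  move=> ba ab; have [z [cz za zmax]] := inv_cand inv (alive _ _ ba).
  have [eq_e|neq_e] := eqVneq [set a; z] [set a; b].
    by rewrite cz (set2_injr eq_e).
  have := lt_total (mem_edges (inv_adj inv za)) (mem_edges (inv_adj inv ba)) neq_e.
  by rewrite (negPf (zmax _ ba)) ab (negPf (max_uv _ (memS _ _ za))).
have cu := best u v vu erefl.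
have cv : cand (local s v) = Some u by apply: best (sym _ _ vu) _; rewrite setUC.
have := unm _ _ cv (reqP _ _ (live _ _ vu) cu).
by apply/eqP/live/vu.
Qed.

(** * The potential and its decrease *)

Definition potential (s : config V) : nat :=
  size (transit s) + \sum_v #|rest (local s v)|.

Lemma finalize_potential (ls : local_state V) :
  #|rest (finalize ls).1| + size (finalize ls).2 <= #|rest ls|.
Proof.
rewrite /finalize; case: (cand ls) => [x|] /=; last by rewrite addn0.
case: ifP => _ /=; last by rewrite addn0.
by rewrite cards0 size_map -cardE subset_leq_card ?subsetDl.
Qed.

(** A new request is sent only when the candidate is lost; the candidate lies in [rest], so its
    removal pays for the request. *)
Lemma handle_drop_potential v u m (ls : local_state V) :
  (forall x, cand ls = Some x -> x \in rest ls) ->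
  #|rest (handle_drop lt v u m ls).1| + size (handle_drop lt v u m ls).2
    <= #|rest ls|.
Proof.
move=> c_in; case: m => /=; first by rewrite addn0.
case: eqP => [/c_in uN|_] /=; last by rewrite addn0 subset_leq_card ?subsetDl.
rewrite (cardsD1 u (rest ls)) uN addnC leq_add2r.
by case: candidate.
Qed.

Lemma potential_receive k p (s : config V) :
  p \in transit s -> ~~ terminated s (dst p) ->
  invariant (local s) (transit s) ->
  potential (receive lt k p s) < potential s.
Proof.
move=> pT nz inv; have := receive_local_transit k p s => /=.
set v := dst p in nz *; set ls := handle_req _ _ _.
have rest_ls : rest ls = rest (local s v) by rewrite /ls; case: (body p).
have c_in x : cand ls = Some x -> x \in rest ls.
  have [y [cy yv _]] := inv_cand inv nz; rewrite rest_ls.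
  suff -> : cand ls = cand (local s v) by rewrite cy => -[<-].
  by rewrite /ls; case: (body p).
have := handle_drop_potential v (src p) (body p) c_in.
case: handle_drop => s3 out3 /= le3; have := finalize_potential s3.
case: finalize => s4 out4 /= le4 ->; rewrite /potential /= !size_cat !size_map.
rewrite size_rem // (bigD1 v) //= [X in _ < _ + X](bigD1 v) //= ffunE eqxx.
rewrite (eq_bigr (fun x => #|rest (local s x)|)); last first.
  by move=> x /negPf xv; rewrite !ffunE xv.
have : 0 < size (transit s) by case: (transit s) pT.
rewrite -rest_ls; move: (size _) (\sum_(i | _) _) => n m n_gt0.
lia.
Qed.

(** Each node with a neighbour sends one request, so packets and neighbour lists each contribute at
    most the degree sum. *)
Lemma potential_wake_up : potential (wake_up adj lt) <= 4 * #|edges adj|.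
Proof.
have sumN := sum_card_neighbours adj.
rewrite /potential (mulnDl 2 2); apply: leq_add; last first.
  by rewrite (eq_bigr (fun v => #|neighbours adj v|)) // => v _; rewrite ffunE.
apply: leq_trans sumN; rewrite /= size_flatten sumnE /shape -map_comp big_map
  big_enum.
apply: leq_sum => v _ /=; rewrite size_map.
have := candidateP (subxx (neighbours adj v)).
by case: candidate => //= x [xN _]; apply/card_gt0P; exists x.
Qed.

End Execution.

(** * Termination of runs *)

Section Run.
Variables (V : finType) (adj : rel V) (lt : rel {set V}).
Hypotheses (adj_sym : symmetric adj) (adj_irr : irreflexive adj).
Hypothesis lt_irr : {in edges adj, forall e, ~~ lt e e}.
Hypothesis lt_trans :
  {in edges adj & &, forall f e g, lt e f -> lt f g -> lt e g}.
Hypothesis lt_total : {in edges adj &, forall e f, e != f -> lt e f || lt f e}.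
Variables (conf : nat -> config V) (ev : nat -> option (packet V)).
Hypothesis run : is_run adj lt conf ev.

Lemma run_invariant k : invariant adj lt (local (conf k)) (transit (conf k)).
Proof.
elim: k => [|k IH]; first by rewrite (run_wake_up run); apply: invariant_wake_up.
case evk: (ev k) => [p|]; last by rewrite (run_idle run evk).
by have [pT nz ->] := run_step run evk; apply: invariant_receive.
Qed.

Lemma run_unmatched k v x :
  cand (local (conf k) v) = Some x -> x \in reqs (local (conf k) v) ->
  rest (local (conf k) v) = set0.
Proof.
elim: k v x => [|k IH] v x; first by rewrite (run_wake_up run) ffunE inE.
case evk: (ev k) => [p|]; last by rewrite (run_idle run evk); apply: IH.
by have [_ _ ->] := run_step run evk; apply: unmatched_receive.
Qed.

Lemma run_potential k p :
  ev k = Some p -> (potential (conf k.+1) < potential (conf k))%N.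
Proof.
move=> evk; have [pT nz ->] := run_step run evk.
exact: potential_receive (run_invariant k).
Qed.

Lemma run_progress k :
  ~~ all_terminated (conf k) -> exists2 j, (k <= j)%N & ev j != None.
Proof.
move=> nt; have [p pT nz] := deadlock_free adj_sym lt_irr lt_trans lt_total
  (run_invariant k) (@run_unmatched k) nt.
have [j le_kj evj] := run_reliable run pT.
have [evj_some|evj_none] := altP (ev j =P None); last by exists j.
case: evj => [|term_j]; first by rewrite evj_some.
(* If the packet is never received, its destination terminates by event [j]; being alive at [k], it
   can do so only through an event in between. *)
suff [i /andP[ki _] evi] : exists2 i, (k <= i < j)%N & ev i != None by exists i.
elim: j le_kj term_j {evj_some} => [|j IH].
  by rewrite leqn0 => /eqP k0; rewrite -k0 (negPf nz).
rewrite leq_eqVlt => /orP[/eqP<-|]; first by rewrite (negPf nz).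
rewrite ltnS => le_kj; case evj: (ev j) => [q|].
  by exists j; rewrite ?le_kj ?ltnSn ?evj.
rewrite (run_idle run evj) => /(IH le_kj)[i /andP[ki ij] evi].
by exists i => //; rewrite ki ltnW.
Qed.

Lemma potential_decreasing i j :
  (i <= j)%N -> (potential (conf j) <= potential (conf i))%N.
Proof.
elim: j => [|j IH]; first by rewrite leqn0 => /eqP->.
rewrite leq_eqVlt => /orP[/eqP-> //|/IH].
case evj: (ev j) => [q|]; last by rewrite (run_idle run evj).
by apply/leq_trans/ltnW/(run_potential evj).
Qed.

(** Induction on a bound for the potential: while a node is alive, some later reception lowers
    it. *)
Lemma run_terminates : exists k, all_terminated (conf k).
Proof.
have [n] := ubnP (potential (conf 0)); elim: n 0%N => // n IH k.
rewrite ltnS => le_n; case: (boolP (all_terminated (conf k))) => [|nt].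
  by exists k.
have [j le_kj] := run_progress nt; case evj: (ev j) => [q|] // _.
apply: (IH j.+1); apply: leq_trans (run_potential evj) _.
exact: leq_trans (potential_decreasing le_kj) le_n.
Qed.

(** * The time bound *)

Section Timing.
Variables (R : realFieldType) (t : nat -> R).
Hypothesis timing : is_timing ev t.

Let budget := potential (wake_up adj lt).

(** The delay of at most one time unit is offset by the loss of at least one unit of potential. *)
Lemma receive_bound k p :
  ev k = Some p -> t (sent p) + (potential (conf k))%:R <= budget%:R ->
  t k.+1 + (potential (conf k.+1))%:R <= budget%:R.
Proof.
move=> evk; apply: le_trans; have := timing_delay timing evk.
rewrite -(lerD2r (potential (conf k.+1))%:R) => /le_trans; apply.
by rewrite -addrA lerD2l nat1r ler_nat (run_potential evk).
Qed.

(* Each reception takes at most one time unit and costs at least one unit of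
   potential, so send times are bounded by the potential already spent. *)
Lemma sent_bound k p :
  p \in transit (conf k) -> t (sent p) + (potential (conf k))%:R <= budget%:R.
Proof.
elim: k p => [|k IH] p.
  rewrite (run_wake_up run) => /flatten_mapP[v _ /mapP[o _ ->]] /=.
  by rewrite (timing_start timing) add0r.
case evk: (ev k) => [q|]; last by rewrite (run_idle run evk); apply: IH.
have [qT _ def_c] := run_step run evk.
have sent_p : p \in transit (conf k.+1) ->
    p \in transit (conf k) \/ sent p = k.+1.
  rewrite def_c /receive; case: iteration => ls out /=.
  by rewrite mem_cat => /orP[/mem_rem|/mapP[o _ ->]]; [left | right].
case/sent_p => [/IH|->]; last exact: receive_bound evk (IH _ qT).
apply: le_trans; rewrite lerD2l ler_nat; exact/ltnW/(run_potential evk).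
Qed.

(** At the first index where all nodes are terminated, minimality makes the last event a reception,
    to which the bound applies. *)
Lemma run_time : exists2 k, all_terminated (conf k) & t k <= budget%:R.
Proof.
case: (ex_minnP run_terminates) => -[|k] term_k min_k;
  [exists 0%N | exists k.+1] => //.
  by rewrite (timing_start timing) ler0n.
case evk: (ev k) => [p|].
  have [pT _ _] := run_step run evk.
  by apply: le_trans (receive_bound evk (sent_bound pT)); rewrite lerDl ler0n.
by have := min_k k; rewrite -(run_idle run evk) term_k ltnn => /(_ isT).
Qed.

End Timing.
End Run.

Theorem theorem2p7 :
  exists C : nat,
    forall (R : realFieldType) (V : finType) (adj : rel V)
           (adj_sym : symmetric adj) (adj_irr : irreflexive adj)
           (w : {set V} -> R)
           (w_gt0 : forall e : {set V}, e \in edges adj -> 0 < w e)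
           (lt : rel {set V}) (lt_order : tie_breaking_order adj w lt)
           (conf : nat -> config V) (ev : nat -> option (packet V))
           (run : is_run adj lt conf ev),
      [/\ exists k : nat, all_terminated (conf k),
          forall k : nat, all_terminated (conf k) ->
            is_matching adj (output (conf k)) /\
            (forall Mstar : {set {set V}},
               is_max_weight_matching adj w Mstar ->
               2^-1 * weight w Mstar <= weight w (output (conf k)))
        & forall t : nat -> R, is_timing ev t ->
            exists2 k : nat,
              all_terminated (conf k) & t k <= C%:R * #|edges adj|%:R].
Proof.
(* The constant bounds the initial potential per edge. *)
exists 4%N => R V adj adj_sym adj_irr w w_gt0 lt.
case=> lt_irr lt_trans lt_total lt_w conf ev run; split.
- exact: (run_terminates adj_sym adj_irr lt_irr lt_trans lt_total run).
- move=> k /forallP term; have rest0 v := eqP (term v).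
  have inv := run_invariant adj_sym adj_irr lt_irr lt_trans run k.
  pose c v := cand (local (conf k) v).
  have c_adj v x : c v = Some x -> adj v x by exact: (inv_cand_adj inv).
  have c_mutual v x : c v = Some x -> c x = Some v.
    move=> cv; have xv := inv_matched inv (rest0 v) cv.
    case: (inv_requested inv (u := x) (v := v)) => // [|[_ /(_ cv)]] //.
    by rewrite /requested xv.
  split=> [|M' [matchM' _]]; first exact: (mutual_is_matching c_adj c_mutual).
  rewrite ler_pdivrMl ?ltr0n // mulr_natl.
  apply: (mutual_half_weight w_gt0 c_adj c_mutual) => // u v uv.
  have dom_w a b : adj a b -> dominates lt (local (conf k)) a b ->
      exists x y, [/\ x \in [set a; b], c x = Some y
                    & w [set a; b] <= w [set x; y]].
    move=> ab [_ [x cx nlt]]; exists a, x; split=> //; first exact: set21.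
    (* [lt] refines the weight order, so an edge not below another in [lt] is at least as heavy. *)
    rewrite leNgt; apply: contra nlt => /lt_w; apply.
      exact/mem_edges/c_adj.
    exact: mem_edges.
  (* At the end every [rest] is empty, so [inv_dom] covers every edge. *)
  have [||] := inv_dom inv uv; rewrite ?rest0 ?inE //; first exact: dom_w.
  by rewrite setUC; apply: dom_w; rewrite adj_sym.
- move=> t timing.
  have [k term_k t_k] :=
    run_time adj_sym adj_irr lt_irr lt_trans lt_total run timing.
  exists k => //; apply: le_trans t_k _; rewrite -natrM ler_nat.
  exact: potential_wake_up.
Qed.
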